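(* Consider the interconnected system, the local optimal control problems $\mathrm{OCP}_i(t)$ and the closed loop described in the context, with $x(0)\in\mathcal X$, under the finite-step small-gain assumption (F), the Lipschitz estimate, recursive feasibility (the problems $\mathrm{OCP}_i(t)$ are feasible for all $t\in\mathbb Z_{\ge0}$ and all $i$), and with a compact set $\mathcal Z$ and functions $V,\sigma_i,\underline\alpha_V,\overline\alpha_V,\omega_V,\widehat\alpha,\widehat\gamma$ as in the context. For $r\in\{0,\dots,M-1\}$ put $Y_r(k):=V(x(r+kM))$ and $R_r(k):=\rho(r+kM)$. Then for every $k\in\mathbb Z_{\ge0}$, $$Y_r(k)\le\max\Bigl\{\widehat\alpha^{(k)}(Y_r(0)),\ \max_{q=0,\dots,k-1}\widehat\alpha^{(k-1-q)}\circ\widehat\gamma(R_r(q))\Bigr\},$$ where the second maximum is zero for $k=0$. Let $\Delta_0:=\Delta(0)$ and let $\kappa_{\mathrm{int}}\in\mathcal K_\infty$ be as in the context. Then $$Y_r(k)\le\max\Bigl\{\widehat\alpha^{(k)}\bigl(\kappa_{\mathrm{int}}(V(x(0)))+\Delta_0\bigr),\ \max_{q=0,\dots,k-1}\widehat\alpha^{(k-1-q)}\circ\widehat\gamma(R_r(q))\Bigr\}.$$ Consequently: (i) If $\rho(t)\le\bar\rho$ for all $t$, then $\limsup_{t\to\infty}V(x(t))\le\widehat\gamma(\bar\rho)$ and $\limsup_{t\to\infty}\|x(t)\|\le\underline\alpha_V^{-1}(\widehat\gamma(\bar\rho))$. The finite offset $\Delta_0$ affects only the transient term (the first term in the second displayed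 bound) and does not enlarge this asymptotic bound. (ii) If $\rho(t)\to0$, then $V(x(t))\to0$ and $x(t)\to0$. (iii) If $\rho(t)=0$ for all $t$, then for every $t=kM+r$ with $r\in\{0,\dots,M-1\}$, $$V(x(t))\le\widehat\alpha^{(k)}\bigl(\kappa_{\mathrm{int}}(V(x(0)))+\Delta_0\bigr).$$ Hence $x(t)\to0$. However, if $\Delta_0>0$ is a fixed offset independent of $x(0)$, this bound by itself does not establish Lyapunov stability of the origin. (iv) Suppose $\rho(t)=0$ for all $t$ and, on the considered domain, there exists $\delta_\Delta\in\mathcal K_\infty$ such that $\Delta_0\le\delta_\Delta(V(x(0)))$. Then the origin is asymptotically stable in $\mathcal X$ and admits a $\mathcal{KL}$ estimate. The exact-consistency case $\Delta_0=0$ is included as a special case.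
   Context: Notation. $\|\cdot\|$ is the Euclidean norm, $\mathbb B_\Delta=\{e:\|e\|\le\Delta\}$, $\mathcal S\ominus\mathcal E=\{z: z+e\in\mathcal S\ \forall e\in\mathcal E\}$. For $v_{\mathcal N_i}=(v_j)_{j\in\mathcal N_i}$, $\|v_{\mathcal N_i}\|_{\mathcal N_i,\infty}=\max_{j\in\mathcal N_i}\|v_j\|$. Maxima over empty index sets are $0$. $\mathcal K$: continuous strictly increasing $\alpha:\mathbb R_{\ge0}\to\mathbb R_{\ge0}$ with $\alpha(0)=0$; $\mathcal K_\infty$: unbounded functions in $\mathcal K$; $\mathcal{KL}$: functions $\beta(s,t)$ of class $\mathcal K$ in $s$ and decreasing to $0$ in $t$; $\alpha<\mathrm{id}$ means $\alpha(s)<s$ for all $s>0$; $\alpha^{(k)}$ is the $k$-fold composition, $\alpha^{(0)}=\mathrm{id}$. Asymptotic stability of the origin in $\mathcal X$ is understood through a $\mathcal{KL}$ estimate: there is $\beta\in\mathcal{KL}$ with $\|x(t)\|\le\beta(\|x(0)\|,t)$ for all $x(0)\in\mathcal X$ and $t\in\mathbb Z_{\ge0}$. System. $x_i(t+1)=g_i(x_i(t),x_{\mathcal N_i}(t),u_i(t))$, $i=1,\dots,\ell$, with constraint sets $\mathcal X_i\subseteq\mathbb R^{n_i}$, $\mathcal U_i\subseteq\mathbb R^{m_i}$, neighbor sets $\mathcal N_i\subset\{1,\dots,\ell\}\setminus\{i\}$, $x_{\mathcal N_i}=(x_j)_{j\in\mathcal N_i}$, $\mathcal X_{\mathcal N_i}=\prod_{j\in\mathcal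 N_i}\mathcal X_j$, $n=\sum_i n_i$, $\mathcal X=\prod_i\mathcal X_i$, $\mathcal U=\prod_i\mathcal U_i$, $x=(x_i)_i$, $u=(u_i)_i$, $g=(g_1,\dots,g_\ell)$, regarded as a map $g:\mathcal X\times\mathcal U\to\mathbb R^n$, $g(0,0)=0$; $g$ is $\mathcal K$-bounded: there are $\kappa_1,\kappa_2\in\mathcal K$ with $\|g(\xi,\mu)\|\le\kappa_1(\|\xi\|)+\kappa_2(\|\mu\|)$ on $\mathcal X\times\mathcal U$ (and likewise each $g_i$ on $\mathcal X_i\times\mathcal X_{\mathcal N_i}\times\mathcal U_i$). Lipschitz estimate: there are $L_{i,1},L_{i,2}>0$, $L_{i,3}\ge0$ with $$\|g_i(\xi_i,\xi_{\mathcal N_i},\mu_i)-g_i(\xi_i',\xi_{\mathcal N_i}',\mu_i')\|\le L_{i,1}\|\xi_i-\xi_i'\|+L_{i,2}\|\xi_{\mathcal N_i}-\xi'_{\mathcal N_i}\|_{\mathcal N_i,\infty}+L_{i,3}\|\mu_i-\mu_i'\|$$ on the constraint domain $\mathcal X_i\times\mathcal X_{\mathcal N_i}\times\mathcal U_i$. Assumption (F). $M\ge2$ is an integer; $W_i:\mathbb R^{n_i}\to\mathbb R_{\ge0}$ are continuous with $\underline\alpha_i(\|\xi_i\|)\le W_i(\xi_i)\le\overline\alpha_i(\|\xi_i\|)$, $\underline\alpha_i,\overline\alpha_i\in\mathcal K_\infty$; $\gamma_{ij}\in\mathcal K_\infty\cup\{0\}$ satisfy $\gamma_{i_1i_2}\circ\cdots\circ\gamma_{i_ri_1}<\mathrm{id}$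 for every cycle of distinct indices, $r=1,\dots,\ell$; and there is an admissible finite-step feedback $q:\mathcal X\to\mathcal U^M$, $q(\xi)=(q^{[0]}(\xi),\dots,q^{[M-1]}(\xi))$, with $W_i(x_i(M,\xi,u_q))\le\max_{j}\gamma_{ij}(W_j(\xi_j))$ for all $\xi\in\mathcal X$ and all $i$. Here $x(0,\xi,u_q)=\xi$, $x(l+1,\xi,u_q)=g(x(l,\xi,u_q),q^{[l]}(\xi))$ for $l=0,\dots,M-1$, and admissible means: for $l=1,\dots,M$, $x(l,\xi,u_q)\in\mathcal X$ for all $\xi\in\mathcal X$ and there is $\kappa_l^q\in\mathcal K$ with $\|x(l,\xi,u_q)\|\le\kappa_l^q(\|\xi\|)$ for all $\xi\in\mathcal X$; put $\kappa_0^q=\mathrm{id}$. Put $\mathcal G_i^\gamma=\{j:\gamma_{ij}\not\equiv0\}$. The optimal control problems below use these $M,W_i,\gamma_{ij}$ and a weight $\lambda>0$. Packets. At time $t$ subsystem $i$ sends $(\bar x_i(l|t),\bar r_i(l|t))_{l=0}^{M-1}$ to the controllers of which it is a neighbor, where $\bar x_i(0|t)=x_i(t)$, $\bar r_i(0|t)=0$, and for $t\ge1$, $l=1,\dots,M-1$: $\bar x_i(l|t)=x_i^{\mathrm{nom},\star}(l+1|t-1)$, $\bar r_i(l|t)=r_i^\star(l+1|t-1)$. At $t=0$ packets (with nonnegative radii) are supplied by a feasible initialization procedure. At time $t$ controller $i$ knows the packets of all $j\in\mathcal N_i$ and the scalars $W_j(x_j(t))$, $j\in\mathcal G_i^\gamma$.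 Budget. $\mathcal B_i(l|t)=L_{i,2}\max_{j\in\mathcal N_i}\bar r_j(l|t)+d_i(l|t)$, $l=0,\dots,M-1$, where $d_i(l|t)=L_{i,2}\max_{j\in\mathcal N_i}\|\bar x_j(l|t)-\bar x_j(l+1|t-1)\|$ for $l\le M-2$ (for $t=0$, given nonnegative initialization values) and $d_i(M-1|t)=d_i^{\mathrm{ter}}(t)\ge0$ is prescribed. $\mathrm{OCP}_i(t)$: minimize over $(u_i(0|t),\dots,u_i(M-1|t))$ and $(r_i(1|t),\dots,r_i(M-1|t))$ the cost $\sum_{l=0}^{M-1}W_i(x_i^{\mathrm{nom}}(l|t))+\lambda\sum_{l=1}^{M-1}r_i(l|t)$ subject to: $x_i^{\mathrm{nom}}(0|t)=x_i(t)$; $x_i^{\mathrm{nom}}(l+1|t)=g_i(x_i^{\mathrm{nom}}(l|t),\bar x_{\mathcal N_i}(l|t),u_i(l|t))$ and $u_i(l|t)\in\mathcal U_i$ for $l=0,\dots,M-1$; $r_i(l|t)\ge0$ and $x_i^{\mathrm{nom}}(l|t)\in\mathcal X_i\ominus\mathbb B_{r_i(l|t)}$ for $l=1,\dots,M-1$; $r_i(l+1|t)\ge L_{i,1}r_i(l|t)+\mathcal B_i(l|t)$ for $l=0,\dots,M-2$, with $r_i(0|t):=0$ fixed; and $W_i(x_i^{\mathrm{nom}}(M|t))\le\max_{j\in\mathcal G_i^\gamma}\gamma_{ij}(W_j(x_j(t)))$. Its optimal value is $J_i^\star(t)$. Optimizers carry a star; existence of a minimizer is understood whenever an optimizer is invoked.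 $r_i^\star(0|t)=0$ and $r_i^\star(M|t):=L_{i,1}r_i^\star(M-1|t)+\mathcal B_i(M-1|t)$. The closed loop applies $u_i(t)=u_i^\star(0|t)$ for every $i$. Mismatch quantities. For $l=0,\dots,M-1$: $p_i(l|t)=\|x_{\mathcal N_i}(t+l)-\bar x_{\mathcal N_i}(l|t)\|_{\mathcal N_i,\infty}$, $\delta_i^u(l|t)=\|u_i^\star(0|t+l)-u_i^\star(l|t)\|$, $\eta_i(l|t)=\max\{L_{i,2}p_i(l|t)+L_{i,3}\delta_i^u(l|t)-\mathcal B_i(l|t),0\}$; $s_i(0|t)=0$, $s_i(l+1|t)=L_{i,1}s_i(l|t)+\eta_i(l|t)$. $\rho(t)=\max_i(r_i^\star(M|t)+s_i(M|t))$. Lyapunov objects. $\mathcal Z\subset\mathbb R^n$ is a compact set containing all $x(t)$ and all $x^{\mathrm{nom},\star}(l|t)=(x_i^{\mathrm{nom},\star}(l|t))_i$, $l=0,\dots,M$, $t\in\mathbb Z_{\ge0}$. $\sigma_i\in\mathcal K_\infty$ satisfy $\sigma_i^{-1}\circ\gamma_{ij}\circ\sigma_j<\mathrm{id}$ for $j\in\mathcal G_i^\gamma$; $V(x)=\max_i\sigma_i^{-1}(W_i(x_i))$; $\underline\alpha_V,\overline\alpha_V,\omega_V\in\mathcal K_\infty$ satisfy $\underline\alpha_V(\|x\|)\le V(x)\le\overline\alpha_V(\|x\|)$ and $|V(z)-V(z')|\le\omega_V(\|z-z'\|)$ for $z,z'\in\mathcal Z$; $\widehat\alpha,\widehat\gamma\in\mathcal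 K_\infty$, $\widehat\alpha<\mathrm{id}$, satisfy $V(x(t+M))\le\max\{\widehat\alpha(V(x(t))),\widehat\gamma(\rho(t))\}$ for all $t\in\mathbb Z_{\ge0}$. (Such objects exist under the stated hypotheses.) Offset. $\psi_i(s)=\sum_{l=0}^{M-1}\overline\alpha_i(\kappa_l^q(s))$; $\delta_{J,i}(\tau)=\max\{J_i^\star(\tau)-\psi_i(\|x(\tau)\|),0\}$; $\varepsilon(\tau)=\max_{r=0,\dots,M-1}\bigl(\sum_{i=1}^\ell(r_i^\star(r|\tau)+s_i(r|\tau))^2\bigr)^{1/2}$; $\Delta(\tau)=\max_i\sigma_i^{-1}(2\delta_{J,i}(\tau))+\omega_V(\varepsilon(\tau))$. $\kappa_{\mathrm{int}}\in\mathcal K_\infty$ is a function such that $V(x(\tau+r))\le\kappa_{\mathrm{int}}(V(x(\tau)))+\Delta(\tau)$ for all $\tau\in\mathbb Z_{\ge0}$, $r=0,\dots,M-1$; one may take $\kappa_{\mathrm{int}}(s)=\max_i\sigma_i^{-1}(2\psi_i(\underline\alpha_V^{-1}(s)))$. *)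

(* Defs.v *)
From HB Require Import structures.
From mathcomp Require Export all_boot all_order all_algebra.
From mathcomp Require Export all_classical all_reals all_analysis.

Set Implicit Arguments.
Unset Strict Implicit.
Unset Printing Implicit Defensive.

Import Order.TTheory GRing.Theory Num.Theory.
Import numFieldNormedType.Exports.

Local Open Scope classical_set_scope.
Local Open Scope ring_scope.

(* Functions on the nonnegative reals are represented by functions R -> R of
   which only the values on [0, +oo[ are constrained or used. *)
Section ComparisonFunctions.
Context {R : realType}.
Implicit Types (a : R -> R) (b : R -> R -> R).

Definition classK a : Prop :=
  [/\ {within [set s : R | 0 <= s], continuous a},
      (forall s s', 0 <= s -> s < s' -> a s < a s') & a 0 = 0].

Definition classKinf a : Prop :=
  classK a /\ (forall B : R, exists2 s, 0 <= s & B < a s).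

(* Since b 0 t = 0 for every t, strict decrease in t is only possible for
   s > 0. *)
Definition classKL b : Prop :=
  [/\ (forall t, 0 <= t -> classK (fun s => b s t)),
      (forall s t t', 0 < s -> 0 <= t -> t < t' -> b s t' < b s t) &
      (forall s, 0 <= s -> b s t @[t --> +oo] --> (0 : R))].

Definition lt_id a : Prop := forall s, 0 < s -> a s < s.

(* The inverse of the restriction to [0, +oo[; meaningful there for a of
   class K-infinity. *)
Definition invK a : R -> R := 'pinv_(fun=> 0) [set s : R | 0 <= s] a.

End ComparisonFunctions.

Section Geometry.
Context {R : realType}.

(* The norm provided by the library on 'rV[R]_k is the sup norm. *)
Definition enorm k (v : 'rV[R]_k) : R := Num.sqrt (\sum_(i < k) v 0 i ^+ 2).

Definition eball k (D : R) : set 'rV[R]_k := [set e | enorm e <= D].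

Definition pdiff k (A E : set 'rV[R]_k) : set 'rV[R]_k :=
  [set z | forall e, E e -> A (z + e)].

End Geometry.

(* The maps dyn are total; the standing estimates constrain them only on the
   constraint domain. *)
Record network (R : realType) (ell : nat) := Network {
  sdim : 'I_ell -> nat;
  idim : 'I_ell -> nat;
  nbr : 'I_ell -> {set 'I_ell};
  Xc : forall i, set 'rV[R]_(sdim i);
  Uc : forall i, set 'rV[R]_(idim i);
  dyn : forall i, 'rV[R]_(sdim i) ->
    (forall j : {j : 'I_ell | j \in nbr i}, 'rV[R]_(sdim (val j))) ->
    'rV[R]_(idim i) -> 'rV[R]_(sdim i)
}.

Arguments Xc {R ell} S i : rename.
Arguments Uc {R ell} S i : rename.
Arguments dyn {R ell} S i z v u : rename.

Section Network.
Context {R : realType} {ell : nat}.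
Variable S : network R ell.

(* R^n with n = \sum_i sdim i, as the product of the R^(sdim i). *)
Definition state := forall i : 'I_ell, 'rV[R]_(sdim S i).
Definition input := forall i : 'I_ell, 'rV[R]_(idim S i).
Definition nstate (i : 'I_ell) :=
  forall j : {j : 'I_ell | j \in nbr S i}, 'rV[R]_(sdim S (val j)).

Definition restr (i : 'I_ell) (z : state) : nstate i := fun j => z (val j).
Arguments restr : clear implicits.

Definition state0 : state := fun=> 0.
Definition input0 : input := fun=> 0.
Definition state_sub (z z' : state) : state := fun i => z i - z' i.

Definition snorm (z : state) : R := Num.sqrt (\sum_(i < ell) enorm (z i) ^+ 2).
Definition inorm (u : input) : R := Num.sqrt (\sum_(i < ell) enorm (u i) ^+ 2).

Definition nnorm (i : 'I_ell) (v : nstate i) : R :=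
  \big[Num.max/0]_(j : {j : 'I_ell | j \in nbr S i}) enorm (v j).

Definition Xset : set state := [set z | forall i, Xc S i (z i)].
Definition Uset : set input := [set u | forall i, Uc S i (u i)].
Definition Xnbr (i : 'I_ell) : set (nstate i) :=
  [set v | forall j, Xc S (val j) (v j)].
Arguments Xnbr : clear implicits.

Definition gmap (z : state) (u : input) : state :=
  fun i => dyn S i (z i) (restr i z) (u i).

(* The origin belongs to the constraint sets because g is a map on
   X x U with g(0, 0) = 0. *)
Record network_assumptions : Prop := {
  net_nbr : forall i, i \notin nbr S i;
  net_X0 : Xset state0;
  net_U0 : Uset input0;
  net_g0 : forall i, gmap state0 input0 i = 0;
  net_gbounded : exists k1 k2 : R -> R, [/\ classK k1, classK k2 &
    forall z u, Xset z -> Uset u ->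
      snorm (gmap z u) <= k1 (snorm z) + k2 (inorm u)];
  net_gibounded : forall i, exists k1 k2 k3 : R -> R,
    [/\ classK k1, classK k2, classK k3 &
    forall z v u, Xc S i z -> Xnbr i v -> Uc S i u ->
      enorm (dyn S i z v u) <= k1 (enorm z) + k2 (nnorm v) + k3 (enorm u)]
}.

Definition lyapunov_stable (phi : state -> nat -> state) : Prop :=
  forall e : R, 0 < e -> exists2 d : R, 0 < d &
    forall z, Xset z -> snorm z < d -> forall t, snorm (phi z t) < e.

(* Trajectories rather than initial states are quantified over because
   minimizers, initial packets and terminal drifts are not unique, so that
   several closed-loop trajectories may start at the same point; the estimate
   is uniform over all of them. *)
Definition asymptotically_stable (T : set (nat -> state)) : Prop :=
  exists2 b : R -> R -> R, classKL b &
    forall x, T x -> Xset (x 0%N) ->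
      forall t : nat, snorm (x t) <= b (snorm (x 0%N)) t%:R.

End Network.
Arguments restr {R ell S} i z.
Arguments Xnbr {R ell} S i.

Record controller (R : realType) (ell : nat) (S : network R ell) := Controller {
  horizon : nat;
  weight : R;
  W : forall i, 'rV[R]_(sdim S i) -> R;
  gain : 'I_ell -> 'I_ell -> R -> R;
  L1 : 'I_ell -> R;
  L2 : 'I_ell -> R;
  L3 : 'I_ell -> R
}.

Arguments W {R ell S} P i z : rename.

(* The signals of one closed-loop execution: xbar, rbar, drift, ustar and rdec
   at t l (i) are the packets, d_i(l|t), u_i^*(l|t) and the decision r_i^*(l|t);
   only entries with l below the horizon are meaningful. *)
Record run (R : realType) (ell : nat) (S : network R ell) := Run {
  traj : nat -> state S;
  xbar : nat -> nat -> state S;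
  rbar : nat -> nat -> 'I_ell -> R;
  drift : nat -> nat -> 'I_ell -> R;
  ustar : nat -> nat -> input S;
  rdec : nat -> nat -> 'I_ell -> R
}.

Section Controller.
Context {R : realType} {ell : nat} {S : network R ell}.
Variable P : controller S.
Local Notation M := (horizon P).
Local Notation state := (state S).
Local Notation input := (input S).

Definition lipschitz_dynamics : Prop :=
  forall i, [/\ 0 < L1 P i, 0 < L2 P i, 0 <= L3 P i &
    forall z z' v v' u u',
      Xc S i z -> Xc S i z' -> Xnbr S i v -> Xnbr S i v' ->
      Uc S i u -> Uc S i u' ->
      enorm (dyn S i z v u - dyn S i z' v' u') <=
        L1 P i * enorm (z - z') + L2 P i * nnorm (fun j => v j - v' j)
        + L3 P i * enorm (u - u')].

(* gain_path i [:: k_1; ...; k_p] j is the composition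
   gain i k_1 \o gain k_1 k_2 \o ... \o gain k_p j. *)
Fixpoint gain_path (i : 'I_ell) (s : seq 'I_ell) (j : 'I_ell) : R -> R :=
  match s with
  | [::] => gain P i j
  | k :: s' => gain P i k \o gain_path k s' j
  end.

Fixpoint xq (q : nat -> state -> input) (xi : state) (l : nat) : state :=
  match l with
  | 0%N => xi
  | l'.+1 => gmap (xq q xi l') (q l' xi)
  end.

Record finite_step_small_gain (alo aup : 'I_ell -> R -> R)
    (q : nat -> state -> input) (kq : nat -> R -> R) : Prop := {
  fs_M : (2 <= M)%N;
  fs_Wcont : forall i, continuous (W P i);
  fs_alo : forall i, classKinf (alo i);
  fs_aup : forall i, classKinf (aup i);
  fs_Wbounds : forall i z,
    alo i (enorm z) <= W P i z /\ W P i z <= aup i (enorm z);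
  fs_gain : forall i j,
    classKinf (gain P i j) \/ (forall s, 0 <= s -> gain P i j s = 0);
  fs_cycle : forall i s, uniq (i :: s) -> lt_id (gain_path i s i);
  fs_qU : forall xi l, Xset xi -> (l < M)%N -> Uset (q l xi);
  fs_qX : forall xi l, Xset xi -> (1 <= l <= M)%N -> Xset (xq q xi l);
  fs_kq0 : forall s, 0 <= s -> kq 0%N s = s;
  fs_kq : forall l, (1 <= l <= M)%N -> classK (kq l);
  fs_qbound : forall xi l, Xset xi -> (1 <= l <= M)%N ->
    snorm (xq q xi l) <= kq l (snorm xi);
  fs_decrease : forall xi i, Xset xi ->
    W P i (xq q xi M i) <= \big[Num.max/0]_(j < ell) gain P i j (W P j (xi j))
}.

Definition Ggamma (i : 'I_ell) : pred 'I_ell :=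
  fun j => `[< exists2 s : R, 0 <= s & gain P i j s != 0 >].

Section OCP.
Variables (i : 'I_ell) (xt : state) (xb : nat -> state) (B : nat -> R).

Fixpoint xnom (u : nat -> 'rV[R]_(idim S i)) (l : nat) : 'rV[R]_(sdim S i) :=
  match l with
  | 0%N => xt i
  | l'.+1 => dyn S i (xnom u l') (restr i (xb l')) (u l')
  end.

Record ocp_feasible (u : nat -> 'rV[R]_(idim S i)) (r : nat -> R) : Prop := {
  ocp_u : forall l, (l < M)%N -> Uc S i (u l);
  ocp_r0 : r 0%N = 0;
  ocp_r : forall l, (1 <= l < M)%N -> 0 <= r l;
  ocp_x : forall l, (1 <= l < M)%N -> pdiff (Xc S i) (eball (r l)) (xnom u l);
  ocp_tube : forall l, (l.+1 < M)%N -> L1 P i * r l + B l <= r l.+1;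
  ocp_terminal : W P i (xnom u M) <=
    \big[Num.max/0]_(j < ell | Ggamma i j) gain P i j (W P j (xt j))
}.

Definition ocp_cost (u : nat -> 'rV[R]_(idim S i)) (r : nat -> R) : R :=
  \sum_(0 <= l < M) W P i (xnom u l) + weight P * \sum_(1 <= l < M) r l.

Definition ocp_minimizer (u : nat -> 'rV[R]_(idim S i)) (r : nat -> R) : Prop :=
  ocp_feasible u r /\
  (forall u' r', ocp_feasible u' r' -> ocp_cost u r <= ocp_cost u' r').

Definition ocp_value : R :=
  inf [set c | exists u r, ocp_feasible u r /\ c = ocp_cost u r].

End OCP.
Arguments xnom : clear implicits.
Arguments ocp_feasible : clear implicits.
Arguments ocp_minimizer : clear implicits.
Arguments ocp_value : clear implicits.

Section ClosedLoop.
Variable w : run S.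

Definition budget (t l : nat) (i : 'I_ell) : R :=
  L2 P i * (\big[Num.max/0]_(j in nbr S i) rbar w t l j) + drift w t l i.

Definition xnomstar (t l : nat) : state :=
  fun i => xnom i (traj w t) (xbar w t) (fun l' => ustar w t l' i) l.

(* r_i^*(l|t) for l = 0, ..., M; the value at l = M is not a decision. *)
Definition rstar (t l : nat) (i : 'I_ell) : R :=
  if l == 0%N then 0
  else if (l < M)%N then rdec w t l i
  else L1 P i * rdec w t M.-1 i + budget t M.-1 i.

Definition Jstar (t : nat) (i : 'I_ell) : R :=
  ocp_value i (traj w t) (xbar w t) (fun l => budget t l i).

Definition recursively_feasible : Prop :=
  forall t i, exists u r,
    ocp_feasible i (traj w t) (xbar w t) (fun l => budget t l i) u r.

Record closed_loop : Prop := {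
  cl_plant : forall t i, traj w t.+1 i = gmap (traj w t) (ustar w t 0%N) i;
  cl_min : forall t i,
    ocp_minimizer i (traj w t) (xbar w t) (fun l => budget t l i)
      (fun l => ustar w t l i) (fun l => rdec w t l i);
  cl_xbar0 : forall t i, xbar w t 0%N i = traj w t i;
  cl_rbar0 : forall t i, rbar w t 0%N i = 0;
  cl_rbar_init : forall l i, (1 <= l < M)%N -> 0 <= rbar w 0%N l i;
  cl_xbar : forall t l i, (1 <= l < M)%N ->
    xbar w t.+1 l i = xnomstar t l.+1 i;
  cl_rbar : forall t l i, (1 <= l < M)%N ->
    rbar w t.+1 l i = rstar t l.+1 i;
  cl_drift_init : forall l i, (l.+1 < M)%N -> 0 <= drift w 0%N l i;
  cl_drift : forall t l i, (l.+1 < M)%N ->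
    drift w t.+1 l i = L2 P i *
      nnorm (restr i (state_sub (xbar w t.+1 l) (xbar w t l.+1)));
  cl_drift_ter : forall t i, 0 <= drift w t M.-1 i
}.

Definition pmis (t l : nat) (i : 'I_ell) : R :=
  nnorm (restr i (state_sub (traj w (t + l)%N) (xbar w t l))).

Definition dumis (t l : nat) (i : 'I_ell) : R :=
  enorm (ustar w (t + l)%N 0%N i - ustar w t l i).

Definition eta (t l : nat) (i : 'I_ell) : R :=
  Num.max (L2 P i * pmis t l i + L3 P i * dumis t l i - budget t l i) 0.

Fixpoint smis (t l : nat) (i : 'I_ell) : R :=
  match l with
  | 0%N => 0
  | l'.+1 => L1 P i * smis t l' i + eta t l' i
  end.

Definition rho (t : nat) : R :=
  \big[Num.max/0]_(i < ell) (rstar t M i + smis t M i).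

Definition psi (aup : 'I_ell -> R -> R) (kq : nat -> R -> R)
    (i : 'I_ell) (s : R) : R :=
  \sum_(0 <= l < M) aup i (kq l s).

Definition deltaJ (aup : 'I_ell -> R -> R) (kq : nat -> R -> R)
    (t : nat) (i : 'I_ell) : R :=
  Num.max (Jstar t i - psi aup kq i (snorm (traj w t))) 0.

Definition epsilon (t : nat) : R :=
  \big[Num.max/0]_(r < M)
    Num.sqrt (\sum_(i < ell) (rstar t r i + smis t r i) ^+ 2).

Definition Delta (aup : 'I_ell -> R -> R) (kq : nat -> R -> R)
    (sigma : 'I_ell -> R -> R) (omV : R -> R) (t : nat) : R :=
  \big[Num.max/0]_(i < ell) invK (sigma i) (2 * deltaJ aup kq t i)
  + omV (epsilon t).

End ClosedLoop.

Definition V (sigma : 'I_ell -> R -> R) (z : state) : R :=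
  \big[Num.max/0]_(i < ell) invK (sigma i) (W P i (z i)).

Record lyapunov_candidate (sigma : 'I_ell -> R -> R) (aloV aupV : R -> R) :
    Prop := {
  lc_sigma : forall i, classKinf (sigma i);
  lc_gain : forall i j, Ggamma i j ->
    lt_id (invK (sigma i) \o gain P i j \o sigma j);
  lc_aloV : classKinf aloV;
  lc_aupV : classKinf aupV;
  lc_bounds : forall z, aloV (snorm z) <= V sigma z /\ V sigma z <= aupV (snorm z)
}.

Record lyapunov_along (sigma : 'I_ell -> R -> R) (ahat : R -> R) (w : run S)
    (Z : set (prod_topology (fun i => 'rV[R]_(sdim S i))))
    (omV ghat : R -> R) : Prop := {
  la_Z : compact Z;
  la_x : forall t, Z (traj w t);
  la_xnom : forall t l, (l <= M)%N -> Z (xnomstar w t l);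
  la_omV : classKinf omV;
  la_modulus : forall z z', Z z -> Z z' ->
    `|V sigma z - V sigma z'| <= omV (snorm (state_sub z z'));
  la_ghat : classKinf ghat;
  la_decrease : forall t, V sigma (traj w (t + M)%N) <=
    Num.max (ahat (V sigma (traj w t))) (ghat (rho w t))
}.

Definition considered_run (sigma : 'I_ell -> R -> R) (ahat : R -> R)
    (w : run S) (Z : set (prod_topology (fun i => 'rV[R]_(sdim S i))))
    (omV ghat : R -> R) : Prop :=
  [/\ closed_loop w, Xset (traj w 0%N), recursively_feasible w &
      lyapunov_along sigma ahat w Z omV ghat].

Definition intermediate_bound (aup : 'I_ell -> R -> R) (kq : nat -> R -> R)
    (sigma : 'I_ell -> R -> R) (w : run S) (omV kint : R -> R) : Prop :=
  forall tau r, (r < M)%N ->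
    V sigma (traj w (tau + r)%N) <=
      kint (V sigma (traj w tau)) + Delta w aup kq sigma omV tau.

End Controller.

Definition residual_term (R : realType) (ahat ghat : R -> R) (Rr : nat -> R)
    (k : nat) : R :=
  \big[Num.max/0]_(q < k) iter (k - 1 - q)%N ahat (ghat (Rr q)).

(* Main.v *)
(* Sampling the decrease inequality every M steps gives a scalar recursion
   Y(k+1) <= max(a(Y(k)), g(R(k))), which unrolls because a is increasing; the
   iterates of a < id tend to 0 because a positive limit L = a(x) would be
   undercut as soon as an iterate falls below x > L. The class K-infinity
   functions are exactly the increasing bijections of [0, +oo[, which yields
   their closure under composition and inversion. *)
Require Import Defs.

Import Order.TTheory GRing.Theory Num.Theory.
Import numFieldNormedType.Exports.

Local Open Scope classical_set_scope.
Local Open Scope ring_scope.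

(** * Comparison functions: monotonicity, surjectivity and inverses *)

Section ComparisonFunctionTheory.
Context {R : realType}.
Implicit Types (a b : R -> R) (s x y : R).

Lemma classK_le {a x y} : classK a -> 0 <= x -> x <= y -> a x <= a y.
Proof.
move=> [_ alt _] x0; rewrite le_eqVlt => /orP[/eqP->//|xy].
exact/ltW/alt.
Qed.

Lemma classK_ge0 {a x} : classK a -> 0 <= x -> 0 <= a x.
Proof. by move=> Ka x0; have [_ _ a0] := Ka; rewrite -{1}a0 classK_le. Qed.

Lemma classK_ltE {a x y} : classK a -> 0 <= x -> 0 <= y -> (a x < a y) = (x < y).
Proof.
move=> Ka x0 y0; case: (ltP x y) => xy; first by case: Ka => _ + _; apply.
by apply/negbTE; rewrite -leNgt classK_le.
Qed.

Lemma classK_inj {a x y} : classK a -> 0 <= x -> 0 <= y -> a x = a y -> x = y.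
Proof.
move=> Ka x0 y0 axy; apply: le_anti.
by rewrite !leNgt -(classK_ltE Ka y0 x0) -(classK_ltE Ka x0 y0) axy ltxx.
Qed.

Lemma classKinf_surj {a y} : classKinf a -> 0 <= y -> exists2 x, 0 <= x & a x = y.
Proof.
move=> [Ka unb] y0; have [b b0 yb] := unb y.
have [ca _ a0] := Ka.
have : exists2 c, c \in `[0, b] & a c = y.
  apply: IVT => //.
    by apply: continuous_subspaceW ca => z /=; rewrite in_itv /= => /andP[].
  by rewrite a0 ge_min y0 le_max (ltW yb) orbT.
by move=> [c]; rewrite in_itv /= => /andP[c0 _] acy; exists c.
Qed.

(* A strictly increasing function onto an interval has no jumps. *)
Lemma classKinf_of_surj {a} :
  (forall x y, 0 <= x -> x < y -> a x < a y) -> a 0 = 0 ->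
  (forall y, 0 <= y -> exists2 x, 0 <= x & a x = y) -> classKinf a.
Proof.
move=> alt a0 asurj.
have ale x y : 0 <= x -> x <= y -> a x <= a y.
  by move=> x0; rewrite le_eqVlt => /orP[/eqP->//|xy]; exact/ltW/alt.
have age0 x : 0 <= x -> 0 <= a x by move=> x0; rewrite -a0 ale.
split; last first.
  move=> B; have [|x x0 ax] := asurj (`|B| + 1); first by rewrite addr_ge0.
  by exists x; rewrite // ax ltr_pwDr // ler_norm.
split => //; apply/subspace_continuousP => s /= s0.
apply/cvgrPdist_lt => e e0; rewrite near_withinE.
(* Preimages of [a s + e / 2] and [a s - e / 2] delimit a neighbourhood of [s] on which [a] stays
   within [e] of [a s]. *)
have [|u u0 au] := asurj (a s + e / 2).
  by rewrite addr_ge0 ?age0 // divr_ge0 // ltW.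
have su : s < u.
  rewrite ltNge; apply/negP => /(ale _ _ u0); rewrite au leNgt => /negP; apply.
  by rewrite ltrDl divr_gt0.
have [l [ls al]] : exists l, l < s /\ forall x, 0 <= x -> l < x -> a s - e < a x.
  (* A negative [a s - e / 2] has no preimage, but then [a s - e] lies below every value of [a], and
     any point left of [s] serves. *)
  have [as_e|as_e] := ltP (a s - e / 2) 0.
    exists (s - 1); split; first by rewrite ltrBlDr ltrDl.
    move=> x x0 _; apply: lt_le_trans (age0 _ x0); apply: le_lt_trans as_e.
    by rewrite lerD2l lerN2 ler_pdivrMr // ler_peMr ?ltW // ltr1n.
  have [l l0 al] := asurj _ as_e; exists l; split.
    rewrite ltNge; apply/negP => /(ale _ _ s0); rewrite al leNgt => /negP; apply.
    by rewrite ltrBlDr ltrDl divr_gt0.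
  move=> x x0 /(alt _ _ l0); rewrite al; apply: le_lt_trans.
  by rewrite lerD2l lerN2 ler_pdivrMr // ler_peMr ?ltW // ltr1n.
near=> x => x0; rewrite /= distrC ltr_distl; apply/andP; split.
  by apply: al => //; near: x; exact: lt_nbhsr.
have : a x < a u by apply: alt => //; near: x; exact: lt_nbhsl.
by rewrite au => /lt_trans; apply; rewrite ltrD2l gtr_pMr // invf_lt1 // ltr1n.
Unshelve. all: by end_near. Qed.

Lemma classKinf_id : classKinf (id : R -> R).
Proof. by apply: classKinf_of_surj => // y y0; exists y. Qed.

Lemma classKinf_comp {a b} : classKinf a -> classKinf b -> classKinf (a \o b).
Proof.
move=> Ka Kb; apply: classKinf_of_surj => /=.
- move=> x y x0 xy; have y0 := le_trans x0 (ltW xy).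
  by rewrite (classK_ltE Ka.1) ?(classK_ltE Kb.1) ?(classK_ge0 Kb.1).
- by have [[_ _ a0] _] := Ka; have [[_ _ b0] _] := Kb; rewrite b0.
- move=> y /(classKinf_surj Ka)[z /(classKinf_surj Kb)[x x0 <-] <-].
  by exists x.
Qed.

Lemma classKinf_iter {a} n : classKinf a -> classKinf (iter n a).
Proof.
by move=> Ka; elim: n => [|n IH]; [exact: classKinf_id|exact: classKinf_comp].
Qed.

Lemma classKinfD {a b} : classKinf a -> classK b -> classKinf (fun s => a s + b s).
Proof.
move=> [Ka aunb] Kb; split; last first.
  move=> B; have [s s0 Bs] := aunb B; exists s => //.
  by rewrite ltr_wpDr // classK_ge0.
have [ca alt a0] := Ka; have [cb blt b0] := Kb.
split; last by rewrite a0 b0 addr0.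
  apply/subspace_continuousP => s s0.
  by apply: cvgD; [move/subspace_continuousP: ca|move/subspace_continuousP: cb];
    apply.
by move=> s s' s0 ss'; rewrite ltrD ?alt ?blt.
Qed.

Lemma classK_scale {c : R} : 0 < c -> classK (fun s => c * s).
Proof.
move=> c0; split; last by rewrite mulr0.
  by apply: continuous_subspaceT => x; exact: mulrl_continuous.
by move=> s s' _ ss'; rewrite ltr_pM2l.
Qed.

Lemma invK_Kl {a y} : classKinf a -> 0 <= y -> 0 <= invK a y /\ a (invK a y) = y.
Proof.
move=> Ka /(classKinf_surj Ka)[x x0 <-]; rewrite /invK.
rewrite pinvKV ?inE //.
by move=> u v; rewrite !inE /=; exact: classK_inj Ka.1.
Qed.

Lemma invK_Kr {a x} : classKinf a -> 0 <= x -> invK a (a x) = x.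
Proof.
move=> Ka x0; have [i0 ai] := invK_Kl Ka (classK_ge0 Ka.1 x0).
exact: classK_inj Ka.1 _ _ ai.
Qed.

Lemma classKinf_invK {a} : classKinf a -> classKinf (invK a).
Proof.
move=> Ka; apply: classKinf_of_surj.
- move=> x y x0 xy; have y0 := le_trans x0 (ltW xy).
  have [ix0 aix] := invK_Kl Ka x0; have [iy0 aiy] := invK_Kl Ka y0.
  by rewrite -(classK_ltE Ka.1) // aix aiy.
- by have [[_ _ a0] _] := Ka; rewrite -{1}a0 invK_Kr.
- by move=> x x0; exists (a x); [exact: classK_ge0 Ka.1 _|exact: invK_Kr].
Qed.

(** * Iterates of a function below the identity *)

Section IterateBelowIdentity.
Context {a : R -> R}.
Hypotheses (Ka : classKinf a) (a_id : lt_id a).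

Lemma iterK_ge0 {n s} : 0 <= s -> 0 <= iter n a s.
Proof. exact: classK_ge0 (classKinf_iter n Ka).1. Qed.

Lemma iterK_le {n x y} : 0 <= x -> x <= y -> iter n a x <= iter n a y.
Proof. exact: classK_le (classKinf_iter n Ka).1. Qed.

Lemma lt_id_le {s} : 0 <= s -> a s <= s.
Proof.
rewrite le_eqVlt => /orP[/eqP<-|/a_id/ltW//].
by have [[_ _ ->] _] := Ka.
Qed.

Lemma iterK_nonincreasing {s} : 0 <= s ->
  {homo (fun n => iter n a s) : m n / (m <= n)%N >-> n <= m}.
Proof.
move=> s0; apply/nonincreasing_seqP => n; rewrite /=.
exact/lt_id_le/iterK_ge0.
Qed.

Lemma iterK_cvg0 {s} : 0 <= s -> iter k a s @[k --> \oo] --> (0 : R).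
Proof.
move=> s0; have lb : has_lbound (range (fun k => iter k a s)).
  by exists 0 => _ [k _ <-]; exact: iterK_ge0.
have cv := nonincreasing_cvgn (iterK_nonincreasing s0) lb.
suff <- : inf (range (fun k => iter k a s)) = 0 by [].
set L := inf _ in cv *.
have L_le k : L <= iter k a s by apply: ge_inf => //; exists k.
have L0 : 0 <= L.
  by apply: lb_le_inf; [exists s, 0%N|move=> _ [k _ <-]; exact: iterK_ge0].
apply/eqP; rewrite eq_le L0 andbT leNgt; apply/negP => L_gt0.
have [x x0 axL] := classKinf_surj Ka L0.
have x_gt0 : 0 < x.
  rewrite lt_neqAle x0 andbT; apply/eqP => x00; move: L_gt0.
  by rewrite -axL -x00; have [[_ _ ->] _] := Ka; rewrite ltxx.
have Lx : L < x by rewrite -axL a_id.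
have [k _ /(_ k (leqnn k)) /= kx] := cvgr_lt _ cv _ Lx.
have := L_le k.+1; rewrite /= leNgt => /negP; apply.
by rewrite -[ltRHS]axL (classK_ltE Ka.1) ?iterK_ge0.
Qed.

End IterateBelowIdentity.
End ComparisonFunctionTheory.

(** * Limits through comparison functions, and a class KL bound *)

Section Limits.
Context {R : realType}.

(** Writing the tolerance as [e = a x] turns [a (u t) < e] into [u t < x] by monotonicity, which
    avoids handling the one-sided continuity of [a] at 0. *)
Lemma classKinf_cvg0 {T : Type} {F : set_system T} {FF : Filter F} {a : R -> R}
    {u : T -> R} : classKinf a -> (forall t, 0 <= u t) ->
  u t @[t --> F] --> (0 : R) -> a (u t) @[t --> F] --> (0 : R).
Proof.
move=> Ka u0 ucv; apply/cvgrPdist_lt => e e0.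
have [x x0 axe] := classKinf_surj Ka (ltW e0).
have [[_ _ a0] _] := Ka.
have x_gt0 : 0 < x.
  by rewrite lt_neqAle x0 andbT; apply/eqP => x00; rewrite -axe -x00 a0 ltxx in e0.
near=> t; rewrite sub0r normrN ger0_norm ?(classK_ge0 Ka.1) //.
rewrite -axe (classK_ltE Ka.1) //; near: t.
exact: cvgr_lt ucv _ x_gt0.
Unshelve. all: by end_near. Qed.

Lemma le_cvg0 {T : Type} {F : set_system T} {FF : Filter F} {u v : T -> R} :
  (forall t, 0 <= u t <= v t) ->
  v t @[t --> F] --> (0 : R) -> u t @[t --> F] --> (0 : R).
Proof.
move=> uv vcv; apply: (@squeeze_cvgr _ _ _ _ (cst 0) v) => //; last exact: cvg_cst.
exact: nearW.
Qed.

(** The upper limit is an infimum of suprema over the sets of the filter, and the set where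
    [u t <= l + e] is one of them. *)
Lemma limn_esup_le_fin (u : nat -> R) (l : R) :
  (forall e, 0 < e -> \forall t \near \oo, u t <= l + e) ->
  (limn_esup (fun t => (u t)%:E) <= l%:E)%E.
Proof.
move=> ul; apply/lee_addgt0Pr => e e0.
apply: (@le_trans _ _ (ereal_sup [set (u t)%:E | t in [set t | u t <= l + e]])).
  by apply: ereal_inf_lbound; exists [set t | u t <= l + e] => //; exact: ul.
by apply: ge_ereal_sup => _ [t /= ut <-]; rewrite lee_fin.
Qed.

(* The term s / (1 + t) only makes the piecewise constant bound strictly
   decreasing in t; continuity in t is not part of classKL. *)
Lemma classKL_iter (M : nat) (a b phi : R -> R) : (0 < M)%N ->
  classKinf a -> lt_id a -> classKinf b -> classKinf phi ->
  classKL (fun s t =>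
    b (iter (Num.truncn t %/ M)%N a (phi s) + (1 + t)^-1 * s)).
Proof.
move=> M0 Ka a_id Kb Kphi.
have Kin t : 0 <= t ->
    classKinf (fun s => iter (Num.truncn t %/ M)%N a (phi s) + (1 + t)^-1 * s).
  move=> t0; apply: classKinfD; last first.
    by apply: classK_scale; rewrite invr_gt0 ltr_pwDl.
  exact: classKinf_comp (classKinf_iter _ Ka) Kphi.
have phi0 s : 0 <= s -> 0 <= phi s by exact: classK_ge0 Kphi.1.
split.
- by move=> t t0; exact: (classKinf_comp Kb (Kin t t0)).1.
- move=> s t t' s0 t0 tt'; have t'0 : 0 <= t' := le_trans t0 (ltW tt').
  have s0' := ltW s0.
  rewrite (classK_ltE Kb.1) ?(classK_ge0 (Kin _ _).1) // ler_ltD //.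
    apply: (iterK_nonincreasing Ka a_id) (phi0 _ s0') _ _ _.
    exact/leq_div2r/le_truncn/ltW.
  by rewrite ltr_pM2r // ltf_pV2 ?ltrD2l // posrE ltr_pwDl.
move=> s s0; have near0 : \forall t \near (+oo : set_system R), 0 <= t.
  exact: nbhs_pinfty_ge.
(* The absolute value makes the argument of [b] nonnegative for every real [t], as [classKinf_cvg0]
   requires; it agrees with [t] near +oo. *)
have cvt : b (iter (Num.truncn t %/ M)%N a (phi s) + (1 + `|t|)^-1 * s)
    @[t --> +oo] --> (0 : R).
  apply: (classKinf_cvg0 Kb).
    by move=> t; rewrite addr_ge0 ?iterK_ge0 ?phi0 // mulr_ge0 ?invr_ge0 ?addr_ge0.
  rewrite -[X in _ --> X]addr0; apply: cvgD.
    apply: (@cvg_comp _ _ _ (fun t : R => (Num.truncn t %/ M)%N)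
              (fun k => iter k a (phi s)) _ \oo).
      apply/cvgnyPge => A; near=> t.
      rewrite leq_divRL // truncn_ge_nat; last by near: t.
      by near: t; exact: nbhs_pinfty_ge.
    exact: (iterK_cvg0 Ka a_id (phi0 _ s0)).
  apply/cvgrPdist_lt => e e0; near=> t.
  have t0 : 0 <= t by near: t.
  have t1 : 0 < 1 + t by rewrite ltr_pwDl.
  rewrite sub0r normrN ger0_norm; last by rewrite mulr_ge0 ?invr_ge0 ?addr_ge0.
  rewrite (ger0_norm t0) mulrC ltr_pdivrMr // -ltr_pdivrMl // mulrC.
  apply: lt_trans (_ : t < _); last by rewrite ltrDr.
  by near: t; apply: nbhs_pinfty_gt; exact: num_real.
apply: cvg_trans cvt; apply: near_eq_cvg; near=> t.
by rewrite ger0_norm //; near: t.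
Unshelve. all: by end_near. Qed.

End Limits.

(** * Scalar recursions sampled with period M *)

Section SampledSequences.
Context {R : realType}.
Context {a : R -> R}.
Hypotheses (Ka : classKinf a) (a_id : lt_id a).

Lemma residual_term_ge0 (g : R -> R) (c : nat -> R) k :
  0 <= residual_term a g c k.
Proof. exact: bigmax_ge_id. Qed.

(** Iterating a function below the identity only shrinks its argument, so each term is at most its
    own [g (c p)]. *)
Lemma residual_term_le (g : R -> R) (c : nat -> R) (B : R) k :
  (forall p, 0 <= g (c p) <= B) -> residual_term a g c k <= B.
Proof.
move=> gB; have B0 : 0 <= B by have /andP[/le_trans] := gB 0%N; apply.
apply: bigmax_le => // p _; have /andP[g0 gBp] := gB p.
apply: le_trans gBp.
exact: (iterK_nonincreasing Ka a_id g0) (leq0n _).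
Qed.

(** Going from [k] to [k.+1] applies [a] once more to every old term and adds the new term
    [g (c k)], which is iterated zero times. *)
Lemma residual_termS (g : R -> R) (c : nat -> R) k :
  Num.max (a (residual_term a g c k)) (g (c k)) <= residual_term a g c k.+1.
Proof.
rewrite ge_max; apply/andP; split; last first.
  by apply: (bigmax_sup ord_max); rewrite //= subn1 subnn.
suff H (B : R) : (forall p : 'I_k, a (iter (k - 1 - p)%N a (g (c p))) <= B) ->
    0 <= B -> a (residual_term a g c k) <= B.
  apply: H; last exact: residual_term_ge0.
  move=> p; apply: (bigmax_sup (widen_ord (leqnSn k) p)); rewrite //= -iterS.
  by rewrite -subnDA add1n subnSK ?ltn_ord // subSS subn0.
(* Being below [B] after [a] passes to maxima; the default value 0 is covered by [a 0 = 0] and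
   [0 <= B]. *)
move=> aB B0; apply: (big_ind (fun x => a x <= B)) => //.
  by have [[_ _ ->] _] := Ka.
by move=> x y ax ay; case: (leP x y).
Qed.

Lemma sampled_bound (g : R -> R) (c y : nat -> R) :
  (forall k, 0 <= y k) ->
  (forall k, y k.+1 <= Num.max (a (y k)) (g (c k))) ->
  forall k, y k <= Num.max (iter k a (y 0%N)) (residual_term a g c k).
Proof.
move=> y0 yS; elim=> [|k IH]; first by rewrite /= le_max lexx.
apply: le_trans (yS k) _; rewrite ge_max; apply/andP; split; last first.
  by rewrite le_max (le_trans _ (residual_termS g c k)) ?orbT // le_max lexx orbT.
apply: le_trans (classK_le Ka.1 (y0 k) IH) _.
case: (leP (iter k a _)) => _; last by rewrite le_max lexx.
by rewrite le_max (le_trans _ (residual_termS g c k)) ?orbT // le_max lexx.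
Qed.

(** Each residue class is restarted at time [T], from which the forcing is at most [B]. The constant
    [C] dominates the M restart values, so a single iteration count [K] brings the transients of all
    classes below [e]. *)
Lemma ultimate_bound (M : nat) (c y : nat -> R) (B e : R) (T : nat) :
  (0 < M)%N -> (forall t, 0 <= y t) -> (forall t, 0 <= c t) ->
  (forall t, y (t + M)%N <= Num.max (a (y t)) (c t)) ->
  (forall t, (T <= t)%N -> c t <= B) -> 0 < e ->
  \forall t \near \oo, y t <= Num.max e B.
Proof.
move=> M0 y0 c0 yM cB e0.
pose C := \big[Num.max/0]_(r < M) y (T + r)%N.
have C0 : 0 <= C by exact: bigmax_ge_id.
have [K _ hK] := cvgr_lt _ (iterK_cvg0 Ka a_id C0) _ e0.
exists (T + K * M)%N => // t /= Tt.
have rM : ((t - T) %% M < M)%N by rewrite ltn_mod.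
pose r := Ordinal rM; pose k := ((t - T) %/ M)%N.
have -> : t = (T + r + k * M)%N.
  rewrite -addnA [(r + _)%N]addnC -divn_eq subnKC //.
  exact: leq_trans (leq_addr _ _) Tt.
(* The forcing [c] is already the final quantity, hence the gain [id]. *)
have := sampled_bound id (fun p => c (T + r + p * M)%N)
  (fun p => y (T + r + p * M)%N).
move=> /(_ (fun=> y0 _)) H; apply: le_trans (H _ k) _.
  by move=> p; rewrite mulSn [(M + _)%N]addnC addnA.
rewrite ge_max !le_max addn0; apply/andP; split; apply/orP; [left|right].
  apply: le_trans (ltW (hK k _)); last first.
    by rewrite /= leq_divRL // leq_subRL ?(leq_trans (leq_addr _ _) Tt).
  apply: iterK_le => //; exact: le_bigmax 0 (fun r : 'I_M => y (T + r)%N) r.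
by apply: residual_term_le => p; rewrite c0 cB // -addnA leq_addr.
Qed.

End SampledSequences.

(** * Consequences for the Lyapunov function and the closed loop *)

Section LyapunovBounds.
Context {R : realType} {ell : nat} {S : network R ell} {P : controller S}.
Context {aup sigma : 'I_ell -> R -> R} {kq : nat -> R -> R}.
Context {aloV aupV ahat : R -> R}.
Hypotheses (M_ge2 : (1 < horizon P)%N)
  (hV : lyapunov_candidate P sigma aloV aupV)
  (Kahat : classKinf ahat) (ahat_id : lt_id ahat).
Local Notation M := (horizon P).
Local Notation V := (V P sigma).

Let M_gt0 : (0 < M)%N := ltnW M_ge2.
Let KaloV : classKinf aloV := lc_aloV hV.
Let KaupV : classKinf aupV := lc_aupV hV.

Lemma V_ge0 z : 0 <= V z.
Proof. exact: bigmax_ge_id. Qed.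

Lemma snorm_ge0 (z : state S) : 0 <= snorm z.
Proof. exact: sqrtr_ge0. Qed.

Lemma snorm_state0 : snorm (state0 S) = 0.
Proof.
rewrite /snorm big1 ?sqrtr0 // => i _.
rewrite /enorm big1 ?sqrtr0 ?expr0n //= => j _.
by rewrite mxE expr0n.
Qed.

Lemma V_eq0 z : snorm z = 0 -> V z = 0.
Proof.
move=> z0; have [_] := lc_bounds hV z; have [[_ _ a0] _] := KaupV.
by rewrite z0 a0 => V0; apply: le_anti; rewrite V0 V_ge0.
Qed.

Lemma snorm_le_invK z : snorm z <= invK aloV (V z).
Proof.
have [aV _] := lc_bounds hV z.
have KI := classKinf_invK KaloV.
rewrite -(invK_Kr KaloV (snorm_ge0 z)).
by apply: (classK_le KI.1) => //; exact: classK_ge0 KaloV.1 (snorm_ge0 z).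
Qed.

Lemma snorm_cvg0 (x : nat -> state S) :
  V (x t) @[t --> \oo] --> (0 : R) -> snorm (x t) @[t --> \oo] --> (0 : R).
Proof.
move=> Vx; apply: (@le_cvg0 _ _ _ _ _ (fun t => invK aloV (V (x t)))).
  by move=> t; rewrite snorm_ge0 snorm_le_invK.
by apply: classKinf_cvg0 Vx; [exact: classKinf_invK|move=> t; exact: V_ge0].
Qed.

(** * Bounds along one execution *)

Section SingleRun.
Context {w : run S} {Z : set (prod_topology (fun i => 'rV[R]_(sdim S i)))}.
Context {omV ghat : R -> R}.
Hypothesis hw : lyapunov_along P sigma ahat w Z omV ghat.
Local Notation Delta0 := (Delta P w aup kq sigma omV 0%N).
Local Notation Y t := (V (traj w t)).

Let Kghat : classKinf ghat := la_ghat hw.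

Lemma rho_ge0 t : 0 <= rho P w t.
Proof. exact: bigmax_ge_id. Qed.

Lemma ghat_rho_le rhobar t : rho P w t <= rhobar ->
  0 <= ghat (rho P w t) <= ghat rhobar.
Proof.
move=> rb; rewrite (classK_ge0 Kghat.1 (rho_ge0 t)) /=.
exact: classK_le Kghat.1 (rho_ge0 t) rb.
Qed.

Lemma Delta_ge0 t : 0 <= Delta P w aup kq sigma omV t.
Proof.
apply: addr_ge0; first exact: bigmax_ge_id.
by apply: classK_ge0 (la_omV hw).1 _; exact: bigmax_ge_id.
Qed.

(** The decrease over M steps holds from every time, so each offset [r] yields its own sampled
    recursion. *)
Lemma run_sampled_bound r k :
  Y (r + k * M) <= Num.max (iter k ahat (Y r))
    (residual_term ahat ghat (fun p => rho P w (r + p * M)%N) k).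
Proof.
have := sampled_bound Kahat ghat (fun p => rho P w (r + p * M)%N)
  (fun p => Y (r + p * M)) (fun=> V_ge0 _).
rewrite mul0n addn0; apply => p.
by rewrite mulSn [(M + _)%N]addnC addnA; exact: la_decrease hw _.
Qed.

Lemma run_ultimate_bound B T e :
  (forall t, (T <= t)%N -> ghat (rho P w t) <= B) -> 0 < e ->
  \forall t \near \oo, Y t <= Num.max e B.
Proof.
move=> gB e0; apply: (ultimate_bound Kahat ahat_id M (fun t => ghat (rho P w t))
  (fun t => Y t) B e T) => // t; first exact: V_ge0.
- exact: classK_ge0 Kghat.1 (rho_ge0 t).
- exact: la_decrease hw t.
Qed.

Lemma run_limn_esup rhobar : (forall t, rho P w t <= rhobar) ->
  (limn_esup (fun t => (Y t)%:E) <= (ghat rhobar)%:E)%E /\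
  (limn_esup (fun t => (snorm (traj w t))%:E) <= (invK aloV (ghat rhobar))%:E)%E.
Proof.
move=> rb; have G0 : 0 <= ghat rhobar.
  by have /andP[/le_trans] := ghat_rho_le _ _ (rb 0%N); apply.
have ub e : 0 < e -> \forall t \near \oo, Y t <= ghat rhobar + e.
  move=> e0; have : \forall t \near \oo, Y t <= Num.max e (ghat rhobar).
    apply: (run_ultimate_bound _ 0) => // t _.
    by have /andP[] := ghat_rho_le _ _ (rb t).
  apply: filterS => t /le_trans; apply.
  by rewrite ge_max lerDr G0 lerDl ltW.
split; apply: limn_esup_le_fin => // e e0.
have [i0 ai] := invK_Kl KaloV G0.
have i0' : 0 <= invK aloV (ghat rhobar) + e by rewrite addr_ge0 // ltW.
(* A tolerance [e] on the norm becomes this tolerance on [V]: the resulting bound on [V] is exactly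
   [aloV (invK aloV (ghat rhobar) + e)]. *)
have gap : 0 < aloV (invK aloV (ghat rhobar) + e) - ghat rhobar.
  by rewrite subr_gt0 -[ltLHS]ai (classK_ltE KaloV.1) // ltrDl.
apply: filterS (ub _ gap) => t; rewrite addrC subrK => Vt.
apply: le_trans (snorm_le_invK _) _; rewrite -[leRHS](invK_Kr KaloV) //.
exact: classK_le (classKinf_invK KaloV).1 (V_ge0 _) Vt.
Qed.

Lemma run_cvg0 : rho P w t @[t --> \oo] --> (0 : R) ->
  (Y t @[t --> \oo] --> (0 : R)) /\ (snorm (traj w t) @[t --> \oo] --> (0 : R)).
Proof.
move=> rho0; suff Y0 : Y t @[t --> \oo] --> (0 : R) by split=> //; exact: snorm_cvg0.
have g0 : ghat (rho P w t) @[t --> \oo] --> (0 : R).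
  exact: classKinf_cvg0 Kghat rho_ge0 rho0.
apply/cvgrPdist_le => e e0.
(* Past [T] the forcing is at most [e]; taking [B = e] as well makes both branches of the ultimate
   bound equal. *)
have [T _ hT] := cvgr_le _ g0 _ e0.
apply: filterS (run_ultimate_bound e T e hT e0) => t.
by rewrite sub0r normrN ger0_norm ?V_ge0 // maxxx.
Qed.

Section IntermediateBound.
Context {kint : R -> R}.
Hypotheses (Kkint : classKinf kint)
  (hint : intermediate_bound P aup kq sigma w omV kint).

Lemma kint_Delta_ge0 : 0 <= kint (Y 0) + Delta0.
Proof. by rewrite addr_ge0 ?Delta_ge0 // (classK_ge0 Kkint.1) // V_ge0. Qed.

(** The intermediate bound at [tau = 0] replaces the starting value of the class of [r]; the
    residual term is untouched, so the offset enters the transient alone. *)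
Lemma run_transient_bound r k : (r < M)%N ->
  Y (r + k * M) <= Num.max (iter k ahat (kint (Y 0) + Delta0))
    (residual_term ahat ghat (fun p => rho P w (r + p * M)%N) k).
Proof.
move=> rM; apply: le_trans (run_sampled_bound r k) _.
rewrite ge_max !le_max lexx orbT andbT.
by rewrite (iterK_le Kahat (V_ge0 _) (hint 0%N r rM)).
Qed.

Lemma run_zero_residual_bound k r : (forall t, rho P w t = 0) -> (r < M)%N ->
  Y (k * M + r) <= iter k ahat (kint (Y 0) + Delta0).
Proof.
move=> rho0 rM; have := run_transient_bound r k rM; rewrite addnC.
have -> : residual_term ahat ghat (fun p => rho P w (r + p * M)%N) k = 0.
  apply: le_anti; rewrite residual_term_ge0 andbT; apply: residual_term_le => // p.
  by have [[_ _ g0] _] := Kghat; rewrite rho0 g0 lexx.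
by rewrite max_l // iterK_ge0 // kint_Delta_ge0.
Qed.

End IntermediateBound.
End SingleRun.

(* Every nonzero point near the origin is sent to a fixed p <> 0 with V p <= D,
   and p is sent to the origin: the offset D hides the jump to p. *)
Lemma fixed_offset_not_stable (kint : R -> R) (D : R) : classKinf kint -> 0 < D ->
  Xset (state0 S) ->
  (forall e : R, 0 < e ->
    exists xi : state S, [/\ Xset xi, 0 < snorm xi & snorm xi < e]) ->
  exists f : state S -> state S,
    [/\ forall i, f (state0 S) i = 0,
        forall xi, Xset xi -> Xset (f xi),
        forall xi, Xset xi -> V xi <= kint (V xi) + D ->
          forall k r : nat, (r < M)%N ->
            V (iter (k * M + r)%N f xi) <= iter k ahat (kint (V xi) + D) &
        ~ lyapunov_stable (fun xi t => iter t f xi)].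
Proof.
move=> Kkint D0 X0 acc.
have [d0 ad] := invK_Kl KaupV (ltW D0).
have d_gt0 : 0 < invK aupV D.
  rewrite lt_neqAle d0 andbT; apply/eqP => dE; move: D0.
  by have [[_ _ a0] _] := KaupV; rewrite -ad -dE a0 ltxx.
have [p [Xp p_gt0 p_lt]] := acc _ d_gt0.
have VpD : V p <= D.
  have [_ /le_trans] := lc_bounds hV p; apply.
  by rewrite -ad; exact: classK_le KaupV.1 (snorm_ge0 p) (ltW p_lt).
(* Testing norms instead of equality of states sends the whole sphere through [p] to the origin. The
   image is contained in {0, p}, so every orbit is at the origin from time 2 on. *)
pose f (z : state S) :=
  if (snorm z == 0) || (snorm z == snorm p) then state0 S else p.
have fz z : f z = state0 S \/ f z = p by rewrite /f; case: ifP; [left|right].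
have f0 : f (state0 S) = state0 S by rewrite /f snorm_state0 eqxx.
have fp : f p = state0 S by rewrite /f eqxx orbT.
have ff z : f (f z) = state0 S by case: (fz z) => ->.
have V0 : V (state0 S) = 0 by exact/V_eq0/snorm_state0.
have it2 n z : iter n.+2 f z = state0 S.
  by elim: n => [|n IH]; [exact: ff|rewrite iterS IH f0].
exists f; split.
- by move=> i; rewrite f0.
- by move=> z _; case: (fz z) => ->.
- move=> z Xz Vz k r rM.
  have K0 : 0 <= kint (V z) by apply: classK_ge0 Kkint.1 _; exact: V_ge0.
  have I0 : 0 <= iter k ahat (kint (V z) + D).
    by apply: iterK_ge0 => //; rewrite addr_ge0 // ltW.
  case E : (k * M + r)%N => [|[|n]]; last by rewrite it2 V0.
    by move: E; case: k I0 => [_ _ //|k _ E]; move: M_gt0; case: M E.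
  (* Time 1 still lies in the first block because [2 <= M], so [ahat] has not yet acted and the
     bound is at least [D], hence at least [V p]. *)
  have k0 : k = 0%N.
    case: (k) E => // k' E; have : (M <= 1)%N by rewrite -E mulSn -addnA leq_addr.
    by rewrite leqNgt M_ge2.
  rewrite k0 /=; have D0' : 0 <= kint (V z) + D by rewrite addr_ge0 // ltW.
  by case: (fz z) => ->; rewrite ?V0 // (le_trans VpD) // lerDr.
(* Stability is tested with radius [snorm p]: a nonzero start of norm below [snorm p] misses the
   sphere and jumps to [p] in one step. *)
move=> /(_ _ p_gt0)[d d0' stab].
have [|z [Xz z_gt0]] := acc (Num.min d (snorm p)); first by rewrite lt_min d0'.
rewrite lt_min => /andP[zd zp].
have := stab z Xz zd 1%N; rewrite /= /f.
by rewrite gt_eqF //= lt_eqF // ltxx.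
Qed.

(** Through [aupV], the quantity [kint + deltaD] bounds the starting value by the initial norm. The
    estimate uses only data shared by all executions, hence is uniform, although [Z], [omV] and
    [ghat] may vary with the run. *)
Lemma run_asymptotically_stable (loop : set (run S))
    (Z : run S -> set (prod_topology (fun i => 'rV[R]_(sdim S i))))
    (omV ghat : run S -> R -> R) (kint deltaD : R -> R) :
  classKinf kint -> classKinf deltaD ->
  (forall w, loop w ->
    [/\ lyapunov_along P sigma ahat w (Z w) (omV w) (ghat w),
        intermediate_bound P aup kq sigma w (omV w) kint,
        (forall t, rho P w t = 0) &
        Delta P w aup kq sigma (omV w) 0%N <= deltaD (V (traj w 0%N))]) ->
  asymptotically_stable [set traj w | w in loop].
Proof.
move=> Kkint KdeltaD hloop.
have Kphi := classKinf_comp (classKinfD Kkint KdeltaD.1) KaupV.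
have Kb := classKinf_invK KaloV.
eexists; first exact: classKL_iter M_gt0 Kahat ahat_id Kb Kphi.
move=> _ [w lw <-] _ t; have [hw hint rho0 hD] := hloop w lw.
rewrite natrK /=; apply: le_trans (snorm_le_invK _) _.
apply: (classK_le Kb.1); first exact: V_ge0.
have := run_zero_residual_bound hw Kkint hint (t %/ M) (t %% M) rho0.
rewrite -divn_eq ltn_mod => /(_ M_gt0) /le_trans; apply.
rewrite ler_wpDr ?mulr_ge0 ?invr_ge0 ?addr_ge0 ?snorm_ge0 //.
apply: iterK_le => //; first exact: (kint_Delta_ge0 hw Kkint).
have [_ Va] := lc_bounds hV (traj w 0%N).
apply: lerD; first exact: classK_le Kkint.1 (V_ge0 _) Va.
by apply: le_trans hD _; exact: classK_le KdeltaD.1 (V_ge0 _) Va.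
Qed.

End LyapunovBounds.

Theorem proposition5
  (R : realType) (ell : nat) (S : network R ell) (P : controller S)
  (alo aup : 'I_ell -> R -> R)
  (q : nat -> state S -> input S) (kq : nat -> R -> R)
  (sigma : 'I_ell -> R -> R) (aloV aupV ahat : R -> R)
  (hS : network_assumptions S)
  (hL : lipschitz_dynamics P)
  (hF : finite_step_small_gain P alo aup q kq)
  (hlambda : 0 < weight P)
  (hV : lyapunov_candidate P sigma aloV aupV)
  (hahat : classKinf ahat) (hahat_id : lt_id ahat) :
  let M := horizon P in
  let V := V P sigma in
  [/\ (* claims about a single closed-loop execution *)
      forall (w : run S) Z (omV ghat : R -> R),
      considered_run P sigma ahat w Z omV ghat ->
      let Delta0 := Delta P w aup kq sigma omV 0%N in
      [/\ (* first bound *)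
          forall r k : nat, (r < M)%N ->
            V (traj w (r + k * M)%N) <=
              Num.max (iter k ahat (V (traj w r)))
                (residual_term ahat ghat (fun p => rho P w (r + p * M)%N) k),
          (* claims involving kappa_int *)
          forall kint : R -> R, classKinf kint ->
            intermediate_bound P aup kq sigma w omV kint ->
            [/\ (* second bound *)
                forall r k : nat, (r < M)%N ->
                  V (traj w (r + k * M)%N) <=
                    Num.max (iter k ahat (kint (V (traj w 0%N)) + Delta0))
                      (residual_term ahat ghat
                         (fun p => rho P w (r + p * M)%N) k),
                (* (i), role of Delta0: it enters only a vanishing transient,
                   the other term being at most the asymptotic bound *)
                iter k ahat (kint (V (traj w 0%N)) + Delta0)
                  @[k --> \oo] --> (0 : R),
                forall rhobar : R, (forall t, rho P w t <= rhobar) ->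
                  forall r k : nat, (r < M)%N ->
                    residual_term ahat ghat
                      (fun p => rho P w (r + p * M)%N) k <= ghat rhobar &
                (* (iii) *)
                (forall t, rho P w t = 0) ->
                  (forall k r : nat, (r < M)%N ->
                    V (traj w (k * M + r)%N) <=
                      iter k ahat (kint (V (traj w 0%N)) + Delta0))
                  /\ (snorm (traj w t) @[t --> \oo] --> (0 : R))],
          (* (i) *)
          forall rhobar : R, (forall t, rho P w t <= rhobar) ->
            (limn_esup (fun t => (V (traj w t))%:E) <= (ghat rhobar)%:E)%E
            /\ (limn_esup (fun t => (snorm (traj w t))%:E)
                  <= (invK aloV (ghat rhobar))%:E)%E &
          (* (ii) *)
          (rho P w t @[t --> \oo] --> (0 : R)) ->
            (V (traj w t) @[t --> \oo] --> (0 : R))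
            /\ (snorm (traj w t) @[t --> \oo] --> (0 : R))],
      (* (iii), last sentence: for a fixed offset D > 0 (and an origin that is
         not isolated in X) the bound is compatible with an X-invariant
         autonomous system fixing the origin that is not Lyapunov stable;
         initial states violating the t = 0 instance of the bound are
         exempted *)
      forall (kint : R -> R) (D : R), classKinf kint -> 0 < D ->
        (forall e : R, 0 < e ->
           exists xi : state S, [/\ Xset xi, 0 < snorm xi & snorm xi < e]) ->
        exists f : state S -> state S,
          [/\ forall i, f (state0 S) i = 0,
              forall xi, Xset xi -> Xset (f xi),
              forall xi, Xset xi -> V xi <= kint (V xi) + D ->
                forall k r : nat, (r < M)%N ->
                  V (iter (k * M + r)%N f xi) <= iter k ahat (kint (V xi) + D) &
              ~ lyapunov_stable (fun xi t => iter t f xi)],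
      (* (iv) for the closed loop, given as a set of executions *)
      forall (loop : set (run S)) Z (omV ghat : run S -> R -> R)
          (kint deltaD : R -> R),
        classKinf kint -> classKinf deltaD ->
        (forall w, loop w ->
          [/\ considered_run P sigma ahat w (Z w) (omV w) (ghat w),
              intermediate_bound P aup kq sigma w (omV w) kint,
              (forall t, rho P w t = 0) &
              Delta P w aup kq sigma (omV w) 0%N <= deltaD (V (traj w 0%N))]) ->
        asymptotically_stable [set traj w | w in loop] &
      (* (iv), exact consistency *)
      forall (loop : set (run S)) Z (omV ghat : run S -> R -> R)
          (kint : R -> R),
        classKinf kint ->
        (forall w, loop w ->
          [/\ considered_run P sigma ahat w (Z w) (omV w) (ghat w),
              intermediate_bound P aup kq sigma w (omV w) kint,
              (forall t, rho P w t = 0) &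
              Delta P w aup kq sigma (omV w) 0%N = 0]) ->
        asymptotically_stable [set traj w | w in loop]].
Proof.
have M_ge2 := fs_M hF.
split.
- move=> w Z omV ghat [_ _ _ hw] Delta0; split.
  + by move=> r k _; apply: (run_sampled_bound hahat hw).
  + move=> kint Kkint hint; split.
    * by move=> r k; apply: (run_transient_bound hahat hw hint).
    * apply: (iterK_cvg0 hahat hahat_id); exact: (kint_Delta_ge0 hw Kkint).
    * move=> rhobar rb r k _; apply: (residual_term_le hahat hahat_id) => p.
      by apply: (ghat_rho_le hw).
    * move=> rho0; split.
        by move=> k r; apply: (run_zero_residual_bound hahat hahat_id hw Kkint hint).
      (* A residual that is identically zero converges to zero, so convergence follows from (ii). *)
      have rho_cvg : rho P w t @[t --> \oo] --> (0 : R).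
        by rewrite (_ : rho P w = cst 0); [exact: cvg_cst|exact/funext].
      exact: (run_cvg0 M_ge2 hV hahat hahat_id hw rho_cvg).2.
  + exact: (run_limn_esup M_ge2 hV hahat hahat_id hw).
  + exact: (run_cvg0 M_ge2 hV hahat hahat_id hw).
- move=> kint D Kkint D0.
  exact: (fixed_offset_not_stable M_ge2 hV hahat kint D Kkint D0 (net_X0 hS)).
- move=> loop Z omV ghat kint deltaD Kkint KdeltaD hloop.
  apply: (run_asymptotically_stable (aup := aup) (kq := kq) M_ge2 hV hahat hahat_id
            loop Z omV ghat kint deltaD Kkint KdeltaD).
  by move=> w /hloop[[_ _ _ hw] hint rho0 hD]; split.
- move=> loop Z omV ghat kint Kkint hloop.
  (* With zero offset the identity can serve as [deltaD], since [V] is nonnegative. *)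
  apply: (run_asymptotically_stable (aup := aup) (kq := kq) M_ge2 hV hahat hahat_id
            loop Z omV ghat kint id Kkint classKinf_id).
  move=> w /hloop[[_ _ _ hw] hint rho0 hD]; split=> //.
  by rewrite hD; exact: V_ge0.
Qed.
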